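(* Let $\mathcal{S}$ be an operator system of dimension at least $2$ and assume that $\phi:\mathcal{S}\to\mathcal{S}^d$ is a complete order isomorphism of $\mathcal{S}$ onto its dual space. Then $\|\phi\|\cdot\|\phi^{-1}\|\ge 2$.
   Context: For an operator system $\mathcal{S}$, $\mathcal{S}^d$ denotes the space of bounded linear functionals on $\mathcal{S}$, with involution $f^*(v)=\overline{f(v^* )}$. It carries two structures. Matrix order: $(f_{ij})\in M_n(\mathcal{S}^d)$ is in $M_n(\mathcal{S}^d)^+$ iff the map $F:\mathcal{S}\to M_n$, $F(v)=(f_{ij}(v))$, is completely positive. Norm: $\mathcal{S}^d$ has the usual dual norm (more generally, $\|(f_{ij})\|_n=\|F\|_{cb}$). A complete order isomorphism between matrix-ordered spaces is a linear bijection $\phi$ such that $\phi$ and $\phi^{-1}$ are completely positive. The norms $\|\phi\|,\|\phi^{-1}\|$ are taken with respect to the norm of $\mathcal{S}$ and the dual norm of $\mathcal{S}^d$. *)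

(* Defs.v *)
From HB Require Import structures.
From mathcomp Require Import all_boot all_order all_algebra.
From mathcomp Require Import complex ring.
From mathcomp Require Import boolp classical_sets functions reals constructive_ereal ereal.

Set Implicit Arguments.
Unset Strict Implicit.
Unset Printing Implicit Defensive.

Import Order.TTheory GRing.Theory Num.Theory.

Local Open Scope ring_scope.
Local Open Scope classical_set_scope.
Local Open Scope sesquilinear_scope.
Local Open Scope complex_scope.
Local Open Scope ring_scope.

HB.mixin Record Lmodule_isStarSpace (R : realType) V of GRing.Lmodule R[i] V := {
  star : V -> V;
  starK : involutive star;
  starD : {morph star : u v / u + v};
  starZ : forall (a : R[i]) (v : V), star (a *: v) = (Num.conj a) *: star v }.

#[short(type="starSpaceType")]
HB.structure Definition StarSpace (R : realType) :=
  {V of GRing.Lmodule R[i] V & Lmodule_isStarSpace R V}.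

Definition mxstar (R : realType) (V : starSpaceType R) (n : nat)
  (X : 'M[V]_n) : 'M[V]_n := \matrix_(i, j) star (X j i).

(* A^* X A, for a scalar matrix A and a matrix X over a vector space. *)
Definition mxcompress (R : realType) (V : lmodType R[i]) (n m : nat)
    (A : 'M[R[i]]_(n, m)) (X : 'M[V]_n) : 'M[V]_m :=
  \matrix_(i, j) \sum_k \sum_l (Num.conj (A k i) * A l j) *: X k l.

HB.mixin Record StarSpace_isMatrixOrdered (R : realType) V of StarSpace R V := {
  mxpos : forall n : nat, set 'M[V]_n;
  mxpos_herm : forall n (X : 'M[V]_n), mxpos n X -> mxstar X = X;
  mxpos0 : forall n, mxpos n 0;
  mxposD : forall n (X Y : 'M[V]_n), mxpos n X -> mxpos n Y -> mxpos n (X + Y);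
  mxposZ : forall n (r : R) (X : 'M[V]_n),
    0 <= r -> mxpos n X -> mxpos n (map_mx (GRing.scale r%:C) X);
  mxpos_anti : forall n (X : 'M[V]_n), mxpos n X -> mxpos n (- X) -> X = 0;
  mxpos_compress : forall n m (A : 'M[R[i]]_(n, m)) (X : 'M[V]_n),
    mxpos n X -> mxpos m (mxcompress A X) }.

#[short(type="matrixOrderedType")]
HB.structure Definition MatrixOrdered (R : realType) :=
  {V of StarSpace R V & StarSpace_isMatrixOrdered R V}.

Arguments mxpos {R s n} X.
Arguments mxpos_herm {R s n} [X] _.
Arguments mxpos0 {R s} n.
Arguments mxposD {R s n} [X Y] _ _.
Arguments mxposZ {R s n} [r X] _ _.
Arguments mxpos_anti {R s n} [X] _ _.
Arguments mxpos_compress {R s n m} A [X] _.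

(* The matrix e_n with e on the diagonal and 0 elsewhere. *)
Definition mxdiagc (V : nmodType) (n : nat) (e : V) : 'M[V]_n :=
  \matrix_(i, j) (e *+ (i == j)).
Arguments mxdiagc {V} n e.

(* Operator systems in the sense of Choi and Effros: matrix-ordered *-vector   *)
(* spaces with an Archimedean matrix order unit.                               *)
HB.mixin Record MatrixOrdered_isOperatorSystem (R : realType) V
    of MatrixOrdered R V := {
  ounit : V;
  ounit_herm : star ounit = ounit;
  ounit_order : forall n (X : 'M[V]_n), mxstar X = X ->
    exists2 r : R, 0 < r & mxpos (mxdiagc n (r%:C *: ounit) + X);
  ounit_arch : forall n (X : 'M[V]_n),
    (forall r : R, 0 < r -> mxpos (mxdiagc n (r%:C *: ounit) + X)) -> mxpos X }.

#[short(type="operatorSystemType")]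
HB.structure Definition OperatorSystem (R : realType) :=
  {V of MatrixOrdered R V & MatrixOrdered_isOperatorSystem R V}.

Arguments ounit_order {R s n} [X] _.
Arguments ounit_arch {R s n} X _.

Definition completely_positive (R : realType) (V W : matrixOrderedType R)
    (f : V -> W) : Prop :=
  forall (n : nat) (X : 'M[V]_n), mxpos X -> mxpos (map_mx f X).

Definition complete_order_iso (R : realType) (V W : matrixOrderedType R)
    (phi : {linear V -> W}) (psi : W -> V) : Prop :=
  [/\ cancel phi psi, cancel psi phi,
      completely_positive phi & completely_positive psi].

Section MatrixSpace.
Variables (R : realType) (n : nat).
Local Notation C := R[i].

Let adj (A : 'M[C]_n) : 'M[C]_n := A ^t*.

Let adjK : involutive adj.
Proof. by move=> A; apply/matrixP => i j; rewrite !mxE conjCK. Qed.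

Let adjD : {morph adj : u v / u + v}.
Proof. by move=> A B; apply/matrixP => i j; rewrite !mxE rmorphD. Qed.

Let adjZ (a : C) (A : 'M[C]_n) : adj (a *: A) = Num.conj a *: adj A.
Proof. by apply/matrixP => i j; rewrite !mxE rmorphM. Qed.

HB.instance Definition _ :=
  Lmodule_isStarSpace.Build R 'M[C]_n adjK adjD adjZ.

Definition mxform k (X : 'M['M[C]_n]_k) (x y : 'I_k -> 'cV[C]_n) : C :=
  \sum_i \sum_j ((x i) ^t* *m X i j *m y j) 0 0.

(* The usual order of M_k(M_n) = M_{kn}: <X x, x> >= 0 for every x in (C^n)^k. *)
Definition mxpsd k : set 'M['M[C]_n]_k := [set X | forall x, 0 <= mxform X x x].

Fact mxformDl k (X : 'M['M[C]_n]_k) x x' y :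
  mxform X (fun i => x i + x' i) y = mxform X x y + mxform X x' y.
Proof.
rewrite /mxform -big_split; apply: eq_bigr => i _ /=.
rewrite -big_split; apply: eq_bigr => j _ /=.
by rewrite linearD map_mxD !mulmxDl mxE.
Qed.

Fact mxformDr k (X : 'M['M[C]_n]_k) x y y' :
  mxform X x (fun i => y i + y' i) = mxform X x y + mxform X x y'.
Proof.
rewrite /mxform -big_split; apply: eq_bigr => i _ /=.
rewrite -big_split; apply: eq_bigr => j _ /=.
by rewrite mulmxDr mxE.
Qed.

Fact mxformZl k (X : 'M['M[C]_n]_k) (a : C) x y :
  mxform X (fun i => a *: x i) y = Num.conj a * mxform X x y.
Proof.
rewrite /mxform mulr_sumr; apply: eq_bigr => i _ /=.
rewrite mulr_sumr; apply: eq_bigr => j _ /=.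
by rewrite linearZ map_mxZ -!scalemxAl mxE.
Qed.

Fact mxformZr k (X : 'M['M[C]_n]_k) (a : C) x y :
  mxform X x (fun i => a *: y i) = a * mxform X x y.
Proof.
rewrite /mxform mulr_sumr; apply: eq_bigr => i _ /=.
rewrite mulr_sumr; apply: eq_bigr => j _ /=.
by rewrite -!scalemxAr mxE.
Qed.

Let basis k (i : 'I_k) (a : 'I_n) : 'I_k -> 'cV[C]_n :=
  fun l => (delta_mx a 0 : 'cV[C]_n) *+ (l == i).

Fact mxform_basis k (X : 'M['M[C]_n]_k) i j a b :
  mxform X (basis i a) (basis j b) = X i j a b.
Proof.
rewrite /mxform (bigD1 i) //= [X in _ + X]big1 ?addr0; last first.
  move=> l /negPf li; apply: big1 => m _.
  by rewrite /basis li mulr0n trmx0 map_mx0 !mul0mx mxE.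
rewrite (bigD1 j) //= [X in _ + X]big1 ?addr0; last first.
  by move=> l /negPf lj; rewrite /basis lj mulr0n mulmx0 mxE.
rewrite /basis !eqxx !mulr1n trmx_delta map_delta_mx -rowE -colE.
by rewrite !mxE.
Qed.

Fact mxpolarization k (X : 'M['M[C]_n]_k) (c : C) x y :
  mxform X (fun i => x i + c *: y i) (fun i => x i + c *: y i) =
  mxform X x x + c * Num.conj c * mxform X y y
    + (Num.conj c * mxform X y x + c * mxform X x y).
Proof. by rewrite mxformDl !mxformDr !mxformZl !mxformZr; ring. Qed.

Fact mxpsd_herm k (X : 'M['M[C]_n]_k) : mxpsd X -> mxstar X = X.
Proof.
move=> pX.
have conjform x y : Num.conj (mxform X y x) = mxform X x y.
  have realE z : 0 <= z -> Num.conj z = z :> C by move=> /ger0_real/CrealP.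
  have xx := realE _ (pX x); have yy := realE _ (pX y).
  have := realE _ (pX (fun i => x i + 1 *: y i)).
  have := realE _ (pX (fun i => x i + 'i%R *: y i)).
  rewrite !mxpolarization !(rmorphD, rmorphM) /= !rmorph1 !conjCK xx yy.
  rewrite conjCi; set p := mxform X y x; set q := mxform X x y => h1 h2.
  set p' := Num.conj p in h1 h2 *; set q' := Num.conj q in h1 h2 *.
  have {}h2 : p' + q' = p + q.
    by move: h2; rewrite !mul1r => /addrI.
  have {}h1 : p' - q' = q - p.
    apply: (mulfI (neq0Ci C)); move: h1.
    rewrite [- 'i%R * 'i%R]mulrC => /addrI h1.
    by rewrite !mulrBr -!mulNr h1 addrC.
  apply: (mulfI (_ : 2 != 0 :> C)); first by rewrite pnatr_eq0.
  have -> : 2 * p' = (p' + q') + (p' - q') by ring.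
  by rewrite h1 h2; ring.
apply/matrixP => i j; rewrite mxE; apply/matrixP => a b.
rewrite !mxE -!mxform_basis; exact: conjform.
Qed.

Fact mxpsd_anti k (X : 'M['M[C]_n]_k) : mxpsd X -> mxpsd (- X) -> X = 0.
Proof.
move=> pX nX.
have formN x y : mxform (- X) x y = - mxform X x y.
  rewrite /mxform -sumrN; apply: eq_bigr => i _; rewrite -sumrN.
  by apply: eq_bigr => j _; rewrite [(- X) i j]mxE mulmxN mulNmx mxE.
have z x : mxform X x x = 0.
  apply/eqP; rewrite eq_le pX andbT -oppr_ge0 -formN; exact: nX.
have h x y : mxform X x y = 0.
  have := z (fun i => x i + 1 *: y i).
  have := z (fun i => x i + 'i%R *: y i).
  rewrite !mxpolarization !z conjCi rmorph1 !mulr0 !add0r !mul1r.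
  set p := mxform X y x; set q := mxform X x y => h1 h2.
  have {}h1 : q - p = 0.
    by apply: (mulfI (neq0Ci C)); rewrite mulr0 -h1; ring.
  apply: (mulfI (_ : 2 != 0 :> C)); first by rewrite pnatr_eq0.
  have -> : 2 * q = (p + q) + (q - p) by ring.
  by rewrite h1 h2 addr0 mulr0.
apply/matrixP => i j; rewrite mxE; apply/matrixP => a b.
by rewrite -mxform_basis h mxE.
Qed.

Fact mxpsd0 k : mxpsd (0 : 'M['M[C]_n]_k).
Proof.
move=> x; rewrite /mxform big1 // => i _; rewrite big1 // => j _.
by rewrite [X in _ *m X *m _]mxE mulmx0 mul0mx mxE.
Qed.

Fact mxpsdD k (X Y : 'M['M[C]_n]_k) : mxpsd X -> mxpsd Y -> mxpsd (X + Y).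
Proof.
move=> pX pY x.
have -> : mxform (X + Y) x x = mxform X x x + mxform Y x x.
  rewrite /mxform -big_split; apply: eq_bigr => i _ /=; rewrite -big_split.
  by apply: eq_bigr => j _ /=; rewrite [(X + Y) i j]mxE mulmxDr mulmxDl mxE.
exact: addr_ge0.
Qed.

Fact mxpsdZ k (r : R) (X : 'M['M[C]_n]_k) :
  0 <= r -> mxpsd X -> mxpsd (map_mx (GRing.scale r%:C) X).
Proof.
move=> r0 pX x.
have -> : mxform (map_mx (GRing.scale r%:C) X) x x = r%:C * mxform X x x.
  rewrite /mxform mulr_sumr; apply: eq_bigr => i _; rewrite mulr_sumr.
  by apply: eq_bigr => j _; rewrite [map_mx _ _ _ _]mxE -scalemxAr -scalemxAl mxE.
by apply: mulr_ge0 => //; rewrite lecR.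
Qed.

Fact mxpsd_compress k m (A : 'M[C]_(k, m)) (X : 'M['M[C]_n]_k) :
  mxpsd X -> mxpsd (mxcompress A X).
Proof.
move=> pX x.
have -> : mxform (mxcompress A X) x x =
    mxform X (fun l => \sum_i A l i *: x i) (fun l => \sum_i A l i *: x i).
  have step i j : ((x i) ^t* *m mxcompress A X i j *m x j) 0 0 =
      \sum_p \sum_l Num.conj (A p i) * A l j *
         (((x i) ^t*) *m X p l *m x j) 0 0.
    rewrite [mxcompress _ _ _ _]mxE mulmx_sumr mulmx_suml summxE; apply: eq_bigr => p _.
    rewrite mulmx_sumr mulmx_suml summxE; apply: eq_bigr => l _.
    by rewrite -scalemxAr -scalemxAl mxE.
  transitivity (\sum_p \sum_l \sum_i \sum_j
     Num.conj (A p i) * A l j * (((x i) ^t*) *m X p l *m x j) 0 0).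
    rewrite /mxform; under eq_bigr do under eq_bigr do rewrite step.
    under eq_bigr do rewrite exchange_big.
    rewrite exchange_big; apply: eq_bigr => p _.
    under eq_bigr do rewrite exchange_big.
    by rewrite exchange_big.
  rewrite /mxform; apply: eq_bigr => p _; apply: eq_bigr => l _.
  have -> : (\sum_i A p i *: x i) ^t* =
      \sum_i Num.conj (A p i) *: ((x i) ^t*) :> 'rV[C]_n.
    apply/matrixP => a b; rewrite !mxE !summxE rmorph_sum.
    by apply: eq_bigr => i _; rewrite !mxE rmorphM.
  rewrite !mulmx_suml summxE.
  apply: eq_bigr => i _; rewrite mulmx_sumr summxE; apply: eq_bigr => j _.
  by rewrite -!scalemxAl -scalemxAr scalerA !mxE.
exact: pX.
Qed.

HB.instance Definition _ := StarSpace_isMatrixOrdered.Build R 'M[C]_n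
  mxpsd_herm mxpsd0 mxpsdD mxpsdZ mxpsd_anti mxpsd_compress.

End MatrixSpace.

Section Norms.
Variable R : realType.

Definition osnorm_mx (S : operatorSystemType R) (r : R) (v : S) : 'M[S]_(1 + 1) :=
  block_mx (const_mx (r%:C *: ounit)) (const_mx v)
           (const_mx (star v)) (const_mx (r%:C *: ounit)).

(* The norm of an operator system: the least r >= 0 such that the matrix       *)
(* [[r e, v], [v^*, r e]] is positive.                                         *)
Definition osnorm (S : operatorSystemType R) (v : S) : R :=
  inf [set r : R | 0 <= r /\ mxpos (osnorm_mx r v)].

(* The supremum is taken in the extended reals: it is +oo exactly when f is    *)
(* not bounded on the unit ball.                                               *)
Definition opnorm (V W : Type) (nV : V -> R) (nW : W -> R) (f : V -> W) : \bar R :=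
  ereal_sup [set (nW (f v))%:E | v in [set v | nV v <= 1]].

Fact mxcompress_perm (V : lmodType R[i]) n (s : 'I_n -> 'I_n) (X : 'M[V]_n) :
  mxcompress (\matrix_(k, i) (k == s i)%:R) X = \matrix_(i, j) X (s i) (s j).
Proof.
apply/matrixP => i j; rewrite !mxE (bigD1 (s i)) //= [X in _ + X]big1 ?addr0.
  rewrite (bigD1 (s j)) //= [X in _ + X]big1 ?addr0.
    by rewrite !mxE !eqxx rmorph1 mulr1 scale1r.
  by move=> l /negPf lj; rewrite !mxE lj mulr0 scale0r.
move=> k /negPf ki; apply: big1 => l _.
by rewrite !mxE ki rmorph0 mul0r scale0r.
Qed.

Fact osnorm_star (S : operatorSystemType R) (v : S) : osnorm (star v) = osnorm v.
Proof.
have imp r (w : S) : mxpos (osnorm_mx r w) -> mxpos (osnorm_mx r (star w)).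
  move/(mxpos_compress (\matrix_(k, i) (k == rev_ord i)%:R)).
  rewrite mxcompress_perm; congr (mxpos _).
  have ordE (k : 'I_(1 + 1)) : k = lshift 1 ord0 \/ k = rshift 1 ord0.
    by case: k => [[|[|//]] Hk]; [left|right]; exact: val_inj.
  have revl : rev_ord (lshift 1 ord0) = rshift 1 ord0 :> 'I_(1 + 1).
    exact: val_inj.
  have revr : rev_ord (rshift 1 ord0) = lshift 1 ord0 :> 'I_(1 + 1).
    exact: val_inj.
  apply/matrixP => i j; rewrite mxE /osnorm_mx.
  by case: (ordE i) => ->; case: (ordE j) => ->; rewrite ?revl ?revr
    ?block_mxEul ?block_mxEur ?block_mxEdl ?block_mxEdr !mxE ?starK.
congr (inf _); apply/seteqP; split=> r /= [r0 h]; split=> //; last exact: imp.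
by rewrite -[v]starK; exact: imp.
Qed.

Fact starN (V : starSpaceType R) (v : V) : star (- v) = - star v.
Proof. by rewrite -scaleN1r starZ rmorphN1 scaleN1r. Qed.

End Norms.

Section Dual.
Variables (R : realType) (S : operatorSystemType R).
Local Notation C := R[i].
Local Notation normc := (@Normc.normc R).

Definition bounded_functional (f : S -> C) : Prop :=
  scalar f /\ exists M : R, forall v, normc (f v) <= M * osnorm v.

Definition bounded_functional_pred : {pred S -> C} :=
  [pred f | `[< bounded_functional f >]].

Record dual := Dual {
  dual_fun :> S -> C;
  dual_funP : dual_fun \in bounded_functional_pred }.

HB.instance Definition _ := [isSub for dual_fun].
HB.instance Definition _ := [Choice of dual by <:].

Lemma dualP (f : dual) : bounded_functional f.
Proof. by case: f => f /= /asboolP. Qed.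

Fact bounded_functional_submod : submod_closed bounded_functional_pred.
Proof.
split.
  apply/asboolP; split=> [a u v|]; first by rewrite /= mulr0 addr0.
  by exists 0 => v; rewrite mul0r Normc.normc0.
move=> a f g /asboolP[lf [M hM]] /asboolP[lg [N hN]].
have E v : (a *: f + g) v = a * f v + g v by [].
apply/asboolP; split=> [b u v|].
  by rewrite !E lf lg; ring.
exists (normc a * M + N) => v; rewrite E mulrDl -mulrA.
have : normc (a * f v + g v) <= normc (a * f v) + normc (g v).
  by rewrite -lecR rmorphD; exact: (ler_normD (a * f v) (g v)).
move/le_trans; apply; apply: lerD; last exact: hN.
rewrite Normc.normcM ler_wpM2l //.
by case: (a) => x y; exact: sqrtr_ge0.
Qed.

HB.instance Definition _ := GRing.isSubmodClosed.Build _ _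
  bounded_functional_pred bounded_functional_submod.
HB.instance Definition _ := [SubChoice_isSubLmodule of dual by <:].

Fact dual_ext (f g : dual) : (forall v, f v = g v) -> f = g.
Proof. by move=> fg; apply/val_inj/funext. Qed.

Fact dual0E v : (0 : dual) v = 0.  Proof. by []. Qed.
Fact dualDE (f g : dual) v : (f + g) v = f v + g v.  Proof. by []. Qed.
Fact dualNE (f : dual) v : (- f) v = - f v.  Proof. by []. Qed.
Fact dualZE a (f : dual) v : (a *: f) v = a * f v.  Proof. by []. Qed.
Fact dual_sumE I r (P : pred I) (F : I -> dual) v :
  (\sum_(i <- r | P i) F i) v = \sum_(i <- r | P i) F i v.
Proof. by apply: (big_morph (fun f : dual => f v)). Qed.

Fact dual_linD (f : dual) u v : f (u + v) = f u + f v.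
Proof. by have [lf _] := dualP f; rewrite -{1}[u]scale1r lf mul1r. Qed.
Fact dual_lin0 (f : dual) : f 0 = 0.
Proof. by apply: (addIr (f 0)); rewrite -dual_linD !add0r. Qed.
Fact dual_linZ (f : dual) a v : f (a *: v) = a * f v.
Proof.
by have [lf _] := dualP f; rewrite -[a *: v]addr0 lf dual_lin0 addr0.
Qed.

Fact dstar_bounded (f : dual) :
  (fun v => Num.conj (f (star v))) \in bounded_functional_pred.
Proof.
have [_ [M hM]] := dualP f; apply/asboolP; split=> [a u v|].
  by rewrite starD starZ dual_linD dual_linZ rmorphD rmorphM /= conjCK.
exists M => v; rewrite -(osnorm_star v).
suff -> : normc (Num.conj (f (star v))) = normc (f (star v)) by exact: hM.
by apply: (@complexI R); exact: (norm_conjC (f (star v))).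
Qed.

Definition dstar (f : dual) : dual := Dual (dstar_bounded f).

Fact dstarK : involutive dstar.
Proof. by move=> f; apply: dual_ext => v /=; rewrite starK conjCK. Qed.
Fact dstarD : {morph dstar : f g / f + g}.
Proof. by move=> f g; apply: dual_ext => v; rewrite /= rmorphD. Qed.
Fact dstarZ (a : C) (f : dual) : dstar (a *: f) = Num.conj a *: dstar f.
Proof. by apply: dual_ext => v; rewrite /= rmorphM. Qed.

HB.instance Definition _ :=
  Lmodule_isStarSpace.Build R dual dstarK dstarD dstarZ.

(* (f_ij) is positive when v |-> (f_ij v) is completely positive from S to M_n. *)
Definition dmxfun n (F : 'M[dual]_n) (v : S) : 'M[C]_n := \matrix_(i, j) F i j v.

Definition dmxpos n : set 'M[dual]_n :=
  [set F | completely_positive (dmxfun F)].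

Fact dmxfun_pos1 n (F : 'M[dual]_n) v : dmxpos F ->
  mxpos (const_mx v : 'M[S]_1) -> mxpos (const_mx (dmxfun F v) : 'M['M[C]_n]_1).
Proof.
move=> pF /pF; congr (mxpos _).
by apply/matrixP => i j; rewrite !mxE.
Qed.

Fact os_span (P : S -> Prop) :
  (forall v, mxpos (const_mx v : 'M[S]_1) -> P v) ->
  (forall a u v, P u -> P v -> P (a *: u + v)) -> forall v, P v.
Proof.
move=> Ppos Plin.
have diag1 r (h : S) :
    mxdiagc 1 (r%:C *: ounit) + const_mx h = const_mx (r%:C *: ounit + h).
  by apply/matrixP => i j; rewrite !mxE !ord1.
have herm1 (h : S) : star h = h -> mxstar (const_mx h : 'M[S]_1) = const_mx h.
  by move=> hh; apply/matrixP => i j; rewrite !mxE.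
have PB a u v : P u -> P v -> P (u + a *: v).
  by move=> Pu Pv; rewrite addrC; apply: Plin.
have star0 : star (0 : S) = 0.
  by apply: (addIr (star 0)); rewrite -starD !add0r.
have Ph h : star h = h -> P h.
  move=> hh.
  have [r r0 pr] := ounit_order (herm1 _ hh).
  have [t t0 pt] := ounit_order (herm1 _ star0).
  rewrite diag1 in pr; rewrite diag1 addr0 in pt.
  have := PB (- (r%:C / t%:C)) _ _ (Ppos _ pr) (Ppos _ pt).
  rewrite scalerA mulNr divfK; last by rewrite (inj_eq (@complexI R) t 0) gt_eqF.
  by rewrite scaleNr addrAC subrr add0r.
move=> v; have i0 : 'i%R != 0 :> C by exact: neq0Ci.
have -> : v = (2^-1 *: (v + star v)) + 'i%R *: ((2 * 'i%R)^-1 *: (v - star v)).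
  rewrite scalerA invfM mulrCA divff // mulr1 -scalerDr addrACA subrr addr0.
  by rewrite -(mulr2n v) -[v *+ 2]scaler_nat scalerA mulVf ?scale1r // pnatr_eq0.
apply: PB; apply: Ph.
  by rewrite starZ starD starK addrC fmorphV rmorph_nat.
rewrite starZ starD starN starK fmorphV rmorphM rmorph_nat /= conjCi.
by rewrite mulrN invrN scaleNr -scalerN opprB.
Qed.

Fact dmxfunP n (F : 'M[dual]_n) i j v : dmxfun F v i j = F i j v.
Proof. by rewrite mxE. Qed.

Fact dmxpos_herm n (F : 'M[dual]_n) : dmxpos F -> mxstar F = F.
Proof.
move=> pF; apply/matrixP => i j; apply: dual_ext; rewrite mxE /=.
apply: os_span => [v pv|a u v hu hv]; last first.
  by rewrite starD starZ !(dual_linD, dual_linZ) rmorphD rmorphM /= conjCK hu hv.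
have /matrixP/(_ 0 0) : mxstar (const_mx v : 'M[S]_1) = const_mx v.
  exact: mxpos_herm.
rewrite !mxE => ->.
have /matrixP/(_ 0 0) := mxpos_herm (dmxfun_pos1 pF pv).
by rewrite !mxE => /matrixP/(_ i j); rewrite !mxE.
Qed.

Fact dmxpos0 n : dmxpos (0 : 'M[dual]_n).
Proof.
move=> k X _; rewrite (_ : map_mx _ _ = 0); first exact: mxpos0.
by apply/matrixP => i j; apply/matrixP => a b; rewrite !mxE.
Qed.

Fact dmxposD n (F G : 'M[dual]_n) : dmxpos F -> dmxpos G -> dmxpos (F + G).
Proof.
move=> pF pG k X pX.
rewrite (_ : map_mx _ _ = map_mx (dmxfun F) X + map_mx (dmxfun G) X).
  by apply: mxposD; [exact: pF|exact: pG].
by apply/matrixP => i j; apply/matrixP => a b; rewrite !mxE.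
Qed.

Fact dmxposZ n (r : R) (F : 'M[dual]_n) :
  0 <= r -> dmxpos F -> dmxpos (map_mx (GRing.scale r%:C) F).
Proof.
move=> r0 pF k X pX.
rewrite (_ : map_mx _ _ = map_mx (GRing.scale r%:C) (map_mx (dmxfun F) X)).
  by apply: mxposZ => //; exact: pF.
by apply/matrixP => i j; apply/matrixP => a b; rewrite !mxE.
Qed.

Fact dmxpos_anti n (F : 'M[dual]_n) : dmxpos F -> dmxpos (- F) -> F = 0.
Proof.
move=> pF nF; apply/matrixP => i j; apply: dual_ext; rewrite mxE.
apply: os_span => [v pv|a u v hu hv]; last first.
  by rewrite !(dual_linD, dual_linZ) hu hv.
have h := dmxfun_pos1 nF pv.
have /matrixP/(_ 0 0) : (const_mx (dmxfun F v) : 'M['M[C]_n]_1) = 0.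
  apply: mxpos_anti; first exact: dmxfun_pos1.
  move: h; congr (mxpos _).
  by apply/matrixP => k l; apply/matrixP => a b; rewrite !mxE.
by rewrite !mxE => /matrixP/(_ i j); rewrite !mxE.
Qed.

(* (A^* F A)(v) = A^* F(v) A, and conjugation by A is completely positive. *)
Fact dmxpos_compress n m (A : 'M[C]_(n, m)) (F : 'M[dual]_n) :
  dmxpos F -> dmxpos (mxcompress A F).
Proof.
move=> pF k X /pF; rewrite /mxpos /= => pX x.
have fE v : dmxfun (mxcompress A F) v = A ^t* *m dmxfun F v *m A.
  apply/matrixP => i j; rewrite !mxE dual_sumE.
  under eq_bigr do rewrite dual_sumE.
  rewrite exchange_big; apply: eq_bigr => l _ /=.
  rewrite !mxE mulr_suml; apply: eq_bigr => p _.
  rewrite !mxE; exact: mulrAC.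
suff -> : mxform (map_mx (dmxfun (mxcompress A F)) X) x x =
    mxform (map_mx (dmxfun F) X) (fun i => A *m x i) (fun i => A *m x i).
  exact: pX.
apply: eq_bigr => i _; apply: eq_bigr => j _.
rewrite ![map_mx _ X _ _]mxE fE trmx_mul map_mxM.
by rewrite !mulmxA.
Qed.

HB.instance Definition _ := StarSpace_isMatrixOrdered.Build R dual
  dmxpos_herm dmxpos0 dmxposD dmxposZ dmxpos_anti dmxpos_compress.

(* [fine] loses nothing: the elements of [dual S] are bounded. *)
Definition dualnorm (f : dual) : R :=
  fine (opnorm (@osnorm R S) normc (f : S -> C)).

End Dual.

Arguments dual {R} S.

Definition dim_ge (R : realType) (V : lmodType R[i]) (n : nat) : Prop :=
  exists b : 'I_n -> V, forall c : 'I_n -> R[i],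
    \sum_i c i *: b i = 0 -> forall i, c i = 0.

(* Main.v *)
Require Import Defs.
From mathcomp Require Import all_boot all_order all_algebra.
From mathcomp Require Import complex lra.
From mathcomp Require Import boolp classical_sets reals constructive_ereal ereal.

(** Write e for the unit of S. The inequality comes from two facts: the dual
    norm of a positive functional f is its value f e at the unit, hence the dual
    norm is additive on positive functionals, whereas the norm of S is far from
    additive on positive elements. Indeed, since dim S >= 2, there is a hermitian
    h that is not a multiple of e. Let [a, b] be the smallest interval such that
    a e <= h <= b e; as S is Archimedean, both bounds are attained. Then
    p = h - a e and q = b e - h are positive, p + q = d e with d = b - a > 0,
    and yet both p and q have norm at least d (lemma [unit_decomposition]).

    The functionals phi p, phi q and phi e are positive, and
      || phi p || + || phi q || = (phi p + phi q) e = d (phi e) e,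
    so that one of phi p, phi q, say phi p, has norm at most d (phi e) e / 2.
    Hence || psi || >= || p || / || phi p || >= 2 / (phi e) e, while
    || phi || >= || phi e || = (phi e) e because || e || <= 1. The product of
    the two bounds is 2. *)

Import Order.TTheory GRing.Theory Num.Theory.

Set Implicit Arguments.
Unset Strict Implicit.
Unset Printing Implicit Defensive.

(** * Positive elements and the order unit *)

Section PositiveElements.
Local Open Scope ring_scope.
Local Open Scope complex_scope.
Variables (R : realType) (V : matrixOrderedType R).
Implicit Types (u v : V) (r : R).

Definition pos v : Prop := mxpos (const_mx v : 'M[V]_1).

Lemma posD u v : pos u -> pos v -> pos (u + v).
Proof.
move=> pu pv; have := mxposD pu pv; congr (mxpos _).
by apply/matrixP => i j; rewrite !mxE.
Qed.

Lemma posZ r v : 0 <= r -> pos v -> pos (r%:C *: v).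
Proof. by move=> r0 /(mxposZ r0); rewrite map_const_mx. Qed.

Lemma pos_anti v : pos v -> pos (- v) -> v = 0.
Proof.
move=> pv nv.
suff /matrixP/(_ ord0 ord0) : const_mx v = 0 :> 'M[V]_1 by rewrite !mxE.
apply: mxpos_anti pv _; move: nv; congr (mxpos _).
by apply/matrixP => i j; rewrite !mxE.
Qed.

Lemma pos_herm v : pos v -> star v = v.
Proof. by move/mxpos_herm => /matrixP/(_ ord0 ord0); rewrite !mxE. Qed.

Lemma star0 : star (0 : V) = 0.
Proof. by apply: (addIr (star 0)); rewrite -starD !add0r. Qed.

End PositiveElements.

Section OrderUnit.
Local Open Scope ring_scope.
Local Open Scope complex_scope.
Variables (R : realType) (S : operatorSystemType R).
Local Notation C := R[i].
Local Notation e := (ounit : S).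
Implicit Types (u v h p : S) (r t : R).

Lemma mxdiagc1D u v : mxdiagc 1 u + const_mx v = const_mx (u + v).
Proof. by apply/matrixP => i j; rewrite !mxE !ord1. Qed.

Lemma pos_order_unit h :
  star h = h -> exists2 r : R, 0 < r & pos (r%:C *: e + h).
Proof.
move=> hh; have : mxstar (const_mx h : 'M[S]_1) = const_mx h.
  by apply/matrixP => i j; rewrite !mxE.
by move/ounit_order => [r r0]; rewrite mxdiagc1D; exists r.
Qed.

Lemma pos_arch v : (forall r, 0 < r -> pos (r%:C *: e + v)) -> pos v.
Proof. by move=> H; apply: ounit_arch => r r0; rewrite mxdiagc1D; exact: H. Qed.

(** Positivity of the unit follows from the domination of the element 0. *)
Lemma pos_unit : pos e.
Proof.
have [r r0] := pos_order_unit (star0 S); rewrite addr0 => pr.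
have rV : 0 <= r^-1 by rewrite invr_ge0 ltW.
by have := posZ rV pr; rewrite scalerA -rmorphM /= mulVf ?gt_eqF // scale1r.
Qed.

Lemma pos_unitZ_ge0 t : e <> 0 -> pos (t%:C *: e) -> 0 <= t.
Proof.
move=> e0 pt; rewrite leNgt; apply/negP => t0; apply: e0.
have tC : t%:C != 0 by rewrite (inj_eq (@complexI R) t 0) lt_eqF.
apply: (scalerI tC); rewrite scaler0; apply: pos_anti => //.
rewrite -scaleNr -rmorphN; apply: posZ; last exact: pos_unit.
by rewrite oppr_ge0 ltW.
Qed.

(** * The norm of an operator system *)

(** Compressing [[r e, v], [v^*, r e]] by the column (1, l), for a phase l,
    gives the first-level inequality - 2 Re (l v) <= 2 r e; this is all that is
    needed to bound the norm of v from below. *)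
Lemma osnorm_mx_compress r v (l : C) : Num.conj l * l = 1 ->
  mxpos (osnorm_mx r v) ->
  pos (r%:C *: e + r%:C *: e + (l *: v + Num.conj l *: star v)).
Proof.
move=> l1 /(mxpos_compress (col_mx (const_mx 1) (const_mx l) : 'M_(1 + 1, 1))).
rewrite /pos; congr (mxpos _); apply/matrixP => i j; rewrite !mxE !ord1.
rewrite big_split_ord !big_ord1 /= !big_split_ord !big_ord1 /= /osnorm_mx.
rewrite !block_mxEul !block_mxEur !block_mxEdl !block_mxEdr.
rewrite !col_mxEu !col_mxEd !mxE l1 !rmorph1 !mul1r mulr1 !scale1r.
by rewrite [Num.conj l *: _ + _]addrC addrACA.
Qed.

(** The matrix [[e, e], [e, e]] is the compression of e by the row (1, 1). *)
Lemma osnorm_mx_unit : mxpos (osnorm_mx 1 e).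
Proof.
have := mxpos_compress (const_mx 1 : 'M_(1, 1 + 1)) pos_unit; congr (mxpos _).
have star_e : star e = e by exact: pos_herm pos_unit.
apply/matrixP => i j; rewrite !mxE !big_ord1 !mxE rmorph1 mulr1 scale1r.
case: split => k; rewrite !mxE; case: split => l;
  by rewrite !mxE ?scale1r ?star_e.
Qed.

(** The infimum that defines the norm of v is over a nonempty set: the
    hermitian matrix [[0, v], [v^*, 0]] is dominated by the order unit. *)
Lemma osnorm_mx_ex v : exists2 r : R, 0 <= r & mxpos (osnorm_mx r v).
Proof.
have ordE (k : 'I_(1 + 1)) : k = lshift 1 ord0 \/ k = rshift 1 ord0.
  by case: k => [[|[|//]] Hk]; [left|right]; exact: val_inj.
have : mxstar (osnorm_mx 0 v) = osnorm_mx 0 v.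
  apply/matrixP => i j; rewrite [LHS]mxE /osnorm_mx.
  by case: (ordE i) => ->; case: (ordE j) => ->; rewrite ?block_mxEul
    ?block_mxEur ?block_mxEdl ?block_mxEdr !mxE ?starK // scale0r star0.
move=> /ounit_order[r r0 pr]; exists r; first exact: ltW.
move: pr; congr (mxpos _); apply/matrixP => i j.
rewrite [LHS]mxE [X in X + _]mxE /osnorm_mx.
by case: (ordE i) => ->; case: (ordE j) => ->; rewrite ?block_mxEul
  ?block_mxEur ?block_mxEdl ?block_mxEdr !mxE ?scale0r ?addr0 ?add0r.
Qed.

Lemma osnorm_le r v : 0 <= r -> mxpos (osnorm_mx r v) -> osnorm v <= r.
Proof. by move=> r0 pr; apply: ge_inf; [exists 0 => t []|]. Qed.

Lemma osnorm_ge t v :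
  (forall r, 0 <= r -> mxpos (osnorm_mx r v) -> t <= r) -> t <= osnorm v.
Proof.
move=> H; apply: lb_le_inf; last by move=> r [r0]; exact: H.
by have [r r0 pr] := osnorm_mx_ex v; exists r.
Qed.

Lemma osnorm_unit_le1 : osnorm e <= 1.
Proof. by apply: osnorm_le => //; exact: osnorm_mx_unit. Qed.

Lemma osnorm0_le0 : osnorm (0 : S) <= 0.
Proof.
apply: osnorm_le => //; move: (@mxpos0 R S (1 + 1)); congr (mxpos _).
have const0 : const_mx 0 = 0 :> 'M[S]_1 by apply/matrixP => i j; rewrite !mxE.
by rewrite /osnorm_mx scale0r star0 const0 block_mx0.
Qed.

Lemma osnormZ_ge t v : 0 < t -> t * osnorm v <= osnorm (t%:C *: v).
Proof.
move=> t0; apply: osnorm_ge => r r0 pr; rewrite mulrC -ler_pdivlMr //.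
apply: osnorm_le; first by rewrite divr_ge0 // ltW.
have tV0 : 0 <= t^-1 by rewrite invr_ge0 ltW.
move: (mxposZ tV0 pr); congr (mxpos _).
have conjC (x : R) : Num.conj x%:C = x%:C.
  by rewrite -[RHS]conj_Creal // complex_real.
have tt : (t^-1)%:C * t%:C = 1 by rewrite -rmorphM /= mulVf ?gt_eqF.
rewrite /osnorm_mx map_block_mx !map_const_mx starZ conjC !scalerA tt !scale1r.
by rewrite -rmorphM /= mulrC.
Qed.

(** On hermitian elements the norm dominates the order-unit norm: the compression
    above with l = -1 yields p <= r e. *)
Lemma osnorm_herm_ge t p : star p = p ->
  (forall r, pos (r%:C *: e - p) -> t <= r) -> t <= osnorm p.
Proof.
move=> hp H; apply: osnorm_ge => r r0 /(@osnorm_mx_compress _ _ (-1)).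
rewrite rmorphN rmorph1 mulrNN mulr1 => /(_ erefl).
rewrite hp scaleN1r addrACA => pr.
apply: H; have h0 : 0 <= 2^-1 :> R by rewrite invr_ge0.
move: (posZ h0 pr); congr pos.
have dbl u : u + u = (1 + 1)%:C *: u.
  by rewrite rmorphD rmorph1 scalerDl scale1r.
by rewrite dbl scalerA -rmorphM /= mulVf ?scale1r // pnatr_eq0.
Qed.

(** * Splitting a multiple of the unit *)

(** The set of all t with t e <= h is nonempty and bounded above because e is an
    order unit, and it contains its supremum because e is Archimedean. *)
Lemma max_unit_minorant h : e <> 0 -> star h = h ->
  exists2 a : R, pos (h - a%:C *: e) & forall t, pos (h - t%:C *: e) -> t <= a.
Proof.
move=> e0 hh; pose E : set R := [set t | pos (h - t%:C *: e)]%classic.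
have [r r0 pr] := pos_order_unit hh.
have Er : E (- r) by rewrite /E /= rmorphN scaleNr opprK addrC.
have [s s0 ps] : exists2 r : R, 0 < r & pos (r%:C *: e - h).
  by apply: pos_order_unit; rewrite starN hh.
have ubE : ubound E s.
  move=> t Et; rewrite -subr_ge0; apply: pos_unitZ_ge0 => //.
  by rewrite rmorphB scalerBl; have := posD ps Et; rewrite addrA subrK.
have supE : has_sup E by split; [exists (- r)|exists s].
exists (sup E) => [|t Et]; last exact: sup_upper_bound.
apply: pos_arch => x x0; have [t Et ht] := sup_adherent x0 supE.
(* x e + h - (sup E) e = (h - t e) + (t - (sup E - x)) e *)
have tx0 : 0 <= t - (sup E - x) by rewrite subr_ge0 ltW.
have := posD Et (posZ tx0 pos_unit); congr pos.
by rewrite !rmorphB /= !scalerBl addrA subrK opprB addrCA.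
Qed.

(** S is the complex span of its positive, hence hermitian, elements; so if
    these were all multiples of e, the dimension would be at most 1. *)
Lemma herm_nonscalar : dim_ge S 2 ->
  exists2 h, star h = h & forall c : C, h <> c *: e.
Proof.
move=> [b bfree]; apply: contrapT => noh.
have scalar_of v : exists c : C, v = c *: e.
  elim/(@os_span R S): v => [v /pos_herm hv|c u v [a ->] [d ->]].
    apply: contrapT => nc; apply: noh; exists v => // c vc.
    by apply: nc; exists c.
  by exists (c * a + d); rewrite scalerDl scalerA.
have [c0 E0] := scalar_of (b 0); have [c1 E1] := scalar_of (b 1).
have b_free x y : x *: b 0 + y *: b 1 = 0 -> x = 0 /\ y = 0.
  pose xy := fun i : 'I_2 => if i == 0 then x else y : C.
  move=> xy0; have := bfree xy; rewrite !big_ord_recl big_ord0 addr0.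
  have -> : lift ord0 ord0 = 1 :> 'I_2 by exact: val_inj.
  by move=> Z; split; [exact: (Z xy0 0)|exact: (Z xy0 1)].
have [_ /eqP] : c1 = 0 /\ - c0 = 0.
  by apply: b_free; rewrite E0 E1 !scalerA mulNr mulrC scaleNr subrr.
rewrite oppr_eq0 => /eqP c00.
have [/eqP] : 1 = 0 :> C /\ 0 = 0 :> C.
  by apply: b_free; rewrite E0 c00 !scale0r scaler0 addr0.
by rewrite oner_eq0.
Qed.

(** The norm fails to be additive on positive elements by a factor 2: here
    p = h - a e and q = b e - h, where [a, b] is the smallest interval with
    a e <= h <= b e. If p <= r e, then h <= (r + a) e, and so r >= b - a. *)
Lemma unit_decomposition : dim_ge S 2 ->
  exists p q, exists d : R, [/\ 0 < d, p + q = d%:C *: e,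
    pos p, pos q & d <= osnorm p /\ d <= osnorm q].
Proof.
move=> /herm_nonscalar[h hh nh].
have hNh : star (- h) = - h by rewrite starN hh.
have e0 : e <> 0.
  move=> e0; apply: (nh 0); rewrite scale0r.
  have [r _] := pos_order_unit hh; rewrite e0 scaler0 add0r => ph.
  have [s _] := pos_order_unit hNh; rewrite e0 scaler0 add0r.
  exact: pos_anti.
(* the upper bound b of the interval is - a' *)
have [a pa maxa] := max_unit_minorant e0 hh.
have [a' pa' maxa'] := max_unit_minorant e0 hNh.
have sumE : (h - a%:C *: e) + (- h - a'%:C *: e) = (- a - a')%:C *: e.
  by rewrite addrACA subrr add0r rmorphB rmorphN /= scalerBl scaleNr.
exists (h - a%:C *: e), (- h - a'%:C *: e), (- a - a'); split => //.
- rewrite lt0r; apply/andP; split; last first.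
    by apply: pos_unitZ_ge0 => //; rewrite -sumE; exact: posD.
  apply/eqP => d0; move: sumE; rewrite d0 scale0r => /eqP.
  rewrite addr_eq0 => /eqP pE; apply: (nh a%:C); apply/eqP; rewrite -subr_eq0.
  by apply/eqP/pos_anti => //; rewrite pE opprK.
- split; apply: osnorm_herm_ge; try exact: pos_herm.
    move=> r pr; have : - r - a <= a'; last by lra.
    apply: maxa'; move: pr; congr pos.
    rewrite rmorphB rmorphN /= scalerBl scaleNr !opprB opprK.
    by rewrite addrCA [RHS]addrCA; congr (_ + _); exact: addrC.
  move=> r pr; have : - r - a' <= a; last by lra.
  apply: maxa; move: pr; congr pos.
  rewrite rmorphB rmorphN /= scalerBl scaleNr !opprB !opprK.
  by rewrite addrCA [RHS]addrCA; congr (_ + _); exact: addrC.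
Qed.

End OrderUnit.

(** * The dual norm of a positive functional *)

Section PositiveFunctionals.
Local Open Scope ring_scope.
Local Open Scope complex_scope.
Variables (R : realType) (S : operatorSystemType R).
Local Notation C := R[i].
Local Notation e := (ounit : S).
Local Notation normc := (@Normc.normc R).
Implicit Types (f : dual S) (v : S).

Definition mass f : R := complex.Re (f e).

Lemma pos_functional_ge0 f v : pos f -> pos v -> 0 <= f v.
Proof.
move=> pf pv; have := dmxfun_pos1 pf pv (fun=> const_mx 1).
rewrite /mxform !big_ord1 !mxE !big_ord1 !mxE !big_ord1 !mxE.
by rewrite rmorph1 mul1r mulr1.
Qed.

Lemma pos_functional_star f v : pos f -> f (star v) = Num.conj (f v).
Proof. by move=> /pos_herm fE; rewrite -{2}fE /= conjCK. Qed.

Lemma massE f : pos f -> f e = (mass f)%:C.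
Proof.
move=> pf; have := pos_functional_ge0 pf (pos_unit S).
rewrite /mass lecE /= => /andP[/eqP h _].
by rewrite [LHS]complexE h rmorph0 mulr0 addr0.
Qed.

Lemma mass_ge0 f : pos f -> 0 <= mass f.
Proof.
move=> pf; have := pos_functional_ge0 pf (pos_unit S).
by rewrite massE // lecR.
Qed.

Lemma normc_le_mass_osnorm_mx f (r : R) v : pos f ->
  mxpos (osnorm_mx r v) -> normc (f v) <= mass f * r.
Proof.
move=> pf prv; set z := f v; set N := normc z.
have NE : N%:C = `|z| by [].
(* the phase l turns the inequality - 2 Re (l v) <= 2 r e into the claim *)
have [l l1 lz] : exists2 l : C, Num.conj l * l = 1 & l * z = - N%:C.
  have [z0|z0] := eqVneq z 0.
    by exists 1; rewrite ?rmorph1 ?mulr1 // NE z0 normr0 mulr0 oppr0.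
  have N0 : N%:C != 0 by rewrite NE normr_eq0.
  have NN : Num.conj z * z = N%:C * N%:C by rewrite mulrC -normCK NE expr2.
  have conjN : Num.conj N%:C = N%:C by rewrite conj_Creal // complex_real.
  exists (- (Num.conj z / N%:C)).
    rewrite rmorphN mulrNN rmorphM fmorphV /= conjN conjCK.
    by rewrite mulrACA [z * _]mulrC NN -invfM divff // mulf_neq0.
  by rewrite mulNr mulrAC NN mulfK.
have := pos_functional_ge0 pf (osnorm_mx_compress l1 prv).
rewrite !(dual_linD, dual_linZ) pos_functional_star // -rmorphM lz massE //.
rewrite rmorphN /= conj_Creal ?complex_real //.
by rewrite -!rmorphM -rmorphN -!rmorphD /= lecR => H; lra.
Qed.

Lemma normc_le_mass f v : pos f -> normc (f v) <= mass f * osnorm v.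
Proof.
move=> pf; have m0 := mass_ge0 pf; have [mz|mnz] := eqVneq (mass f) 0.
  have [r _ pr] := osnorm_mx_ex v.
  by have := normc_le_mass_osnorm_mx pf pr; rewrite mz !mul0r.
have mp : 0 < mass f by rewrite lt0r mnz.
rewrite mulrC -ler_pdivrMr //; apply: osnorm_ge => r r0 pr.
by rewrite ler_pdivrMr // mulrC; exact: normc_le_mass_osnorm_mx.
Qed.

(** The supremum that defines the dual norm of f is attained at the unit. *)
Lemma dualnorm_pos f : pos f -> dualnorm f = mass f.
Proof.
move=> pf; have m0 := mass_ge0 pf.
rewrite /dualnorm; suff -> : opnorm (@osnorm R S) normc f = (mass f)%:E by [].
apply/eqP; rewrite eq_le; apply/andP; split.
  apply: ge_ereal_sup => _ [v /= v1 <-]; rewrite lee_fin.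
  apply: le_trans (normc_le_mass v pf) _; rewrite -[leRHS]mulr1.
  exact: ler_wpM2l.
apply: ereal_sup_ubound; exists e; first exact: osnorm_unit_le1.
congr (_%:E); apply: (@complexI R).
by rewrite -[LHS]/(`|f e|) massE // ger0_norm // lecR.
Qed.

End PositiveFunctionals.

(** * Bounds for an order isomorphism onto the dual *)

Section CompleteOrderIsomorphism.
Local Open Scope ring_scope.
Local Open Scope complex_scope.
Variables (R : realType) (S : operatorSystemType R).
Variables (phi : {linear S -> dual S}) (psi : dual S -> S).
Local Notation e := (ounit : S).

Hypothesis phi_iso : complete_order_iso phi psi.

Lemma iso_pos p : pos p -> pos (phi p).
Proof. by case: phi_iso => _ _ cp _ /cp; rewrite map_const_mx. Qed.

(** This is || p || / || phi p || <= || psi ||, tested on phi p rescaled to norm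
    1. Injectivity of phi excludes || phi p || = 0. *)
Lemma opnorm_inverse_ge p (d : R) : pos p -> 0 < d -> d <= osnorm p ->
  0 < mass (phi p) /\
  ((d / mass (phi p))%:E <= opnorm (@dualnorm R S) (@osnorm R S) psi)%E.
Proof.
move=> pp d0 dp; have [phiK _ _ _] := phi_iso.
have pf := iso_pos pp; have m0 := mass_ge0 pf.
have mp : 0 < mass (phi p).
  rewrite lt0r m0 andbT; apply/eqP => mz.
  have phip0 : phi p = 0.
    apply: dual_ext => v; apply: Normc.eq0_normc; apply/eqP.
    have := normc_le_mass v pf; rewrite mz mul0r => le0; rewrite eq_le le0.
    by case: (phi p v) => x y; exact: sqrtr_ge0.
  have p0 : p = 0 by rewrite -[p]phiK phip0 -(linear0 phi) phiK.
  have : osnorm p <= 0 by rewrite p0; exact: osnorm0_le0.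
  by move=> /(lt_le_trans (lt_le_trans d0 dp)); rewrite ltxx.
split=> //; set m := mass (phi p) in m0 mp *.
have mV : 0 < m^-1 by rewrite invr_gt0.
pose p' : S := (m^-1)%:C *: p.
have pp' : pos p' by apply: posZ => //; exact: ltW.
have m1 : mass (phi p') = 1.
  apply: (@complexI R); rewrite -massE; last exact: iso_pos.
  by rewrite linearZ dualZE massE // -rmorphM /= mulVf ?gt_eqF.
apply: (@le_trans _ _ (osnorm p')%:E).
  rewrite lee_fin mulrC; apply: le_trans (osnormZ_ge _ mV).
  by rewrite ler_pM2l.
have n1 : dualnorm (phi p') <= 1 by rewrite (dualnorm_pos (iso_pos pp')) m1.
by apply: ereal_sup_ubound; exists (phi p'); [exact: n1|rewrite phiK].
Qed.

Lemma opnorm_iso_ge :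
  ((mass (phi e))%:E <= opnorm (@osnorm R S) (@dualnorm R S) phi)%E.
Proof.
apply: ereal_sup_ubound; exists e; first exact: osnorm_unit_le1.
by rewrite (dualnorm_pos (iso_pos (pos_unit S))).
Qed.

End CompleteOrderIsomorphism.

Unset Implicit Arguments.

Theorem proposition3p1 (R : realType) (S : operatorSystemType R)
    (phi : {linear S -> dual S}) (psi : dual S -> S) :
  dim_ge S 2 ->
  complete_order_iso phi psi ->
  (2%:E <= opnorm (@osnorm R S) (@dualnorm R S) phi
           * opnorm (@dualnorm R S) (@osnorm R S) psi)%E.
Proof.
move=> dim2 iso.
have [p [q [d [d0 pqE pp pq [dp dq]]]]] := unit_decomposition dim2.
have [mp psip] := opnorm_inverse_ge iso pp d0 dp.
have [mq psiq] := opnorm_inverse_ge iso pq d0 dq.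
have phie := opnorm_iso_ge iso.
have massC x : pos x -> ((mass (phi x))%:C)%C = phi x ounit.
  by move=> px; rewrite -massE //; exact: iso_pos iso _ px.
have sumE : (mass (phi p) + mass (phi q) = d * mass (phi ounit))%R.
  apply: (@complexI R); rewrite rmorphD rmorphM /= !massC //; last exact: pos_unit.
  by rewrite -dualDE -linearD pqE linearZ dualZE.
move: psip psiq phie mp mq sumE.
set m := mass (phi ounit); set a := mass (phi p); set b := mass (phi q).
move=> psip psiq phie a0 b0 abE.
have m0 : (0 < m)%R by rewrite -(pmulr_rgt0 _ d0) -abE addr_gt0.
have psi_ge : ((2 / m)%:E <= opnorm (@dualnorm R S) (@osnorm R S) psi)%E.
  have le2 (c : R) : (0 < c -> c + c <= d * m -> 2 / m <= d / c)%R.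
    by move=> c0 H; rewrite ler_pdivrMr // mulrAC ler_pdivlMr //; lra.
  have [ab|/ltW ba] := leP a b.
    by apply: le_trans psip; rewrite lee_fin; apply: le2 => //; lra.
  by apply: le_trans psiq; rewrite lee_fin; apply: le2 => //; lra.
have -> : (2%:E = m%:E * (2 / m)%:E :> \bar R)%E.
  by rewrite -EFinM mulrC divfK ?gt_eqF.
by apply: lee_pmul => //; rewrite lee_fin ?divr_ge0 ?ltW.
Qed.
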